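(* Let $\mathbb{F}$ be an algebraically closed field of characteristic zero and let $(\mathcal{P},\circ,\{\cdot,\cdot\})$ be a finite-dimensional transposed Poisson algebra over $\mathbb{F}$ such that $\{\mathcal{P},\mathcal{P}\}=\mathcal{P}$. Then the associative commutative algebra $(\mathcal{P},\circ)$ is nilpotent.
   Context: A transposed Poisson algebra is a vector space $\mathcal{P}$ with an associative commutative multiplication $\circ$ (not necessarily unital) and a Lie bracket $\{\cdot,\cdot\}$ such that $2x\circ\{y,z\}=\{x\circ y,z\}+\{y,x\circ z\}$ for all $x,y,z\in\mathcal{P}$. $\{\mathcal{P},\mathcal{P}\}$ is the linear span of all brackets. *)

(* Defs.v *)
From HB Require Import structures.
From mathcomp Require Import all_boot all_order all_algebra.

Set Implicit Arguments.
Unset Strict Implicit.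
Unset Printing Implicit Defensive.

Import GRing.Theory.
Local Open Scope ring_scope.

Section BilinearProducts.

Variables (F : fieldType) (P : vectType F).
Implicit Types (m br : {bilinear P -> P -> P}) (U V W : {vspace P}).

(* The linear span of all m u v with u in U and v in V. It is computed from    *)
(* bases, as prodv is for unital algebras; bilin_spanP shows that it is the    *)
(* least subspace containing every m u v.                                      *)
Definition bilin_span m U V : {vspace P} :=
  <<[seq m u v | u <- vbasis U, v <- vbasis V]>>%VS.

Lemma memv_bilin_span m U V u v :
  u \in U -> v \in V -> m u v \in bilin_span m U V.
Proof.
move=> Uu Vv; rewrite (coord_vbasis Uu) (coord_vbasis Vv).
rewrite linear_sumlz; apply: memv_suml => i _.
rewrite linear_sumr; apply: memv_suml => j _.
rewrite linearZr_LR linearZl_LR /=; do 2!apply: memvZ.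
by apply: memv_span; apply: allpairs_f; apply: mem_nth; rewrite size_tuple.
Qed.

Lemma bilin_spanP m U V W :
  reflect (forall u v, u \in U -> v \in V -> m u v \in W)
          (bilin_span m U V <= W)%VS.
Proof.
apply: (iffP idP) => [sW u v Uu Vv | mW].
  exact: (subvP sW) (memv_bilin_span m Uu Vv).
apply/span_subvP => _ /allpairsP[[u v] /= [Uu Vv ->]].
by apply: mW; apply: vbasis_mem.
Qed.

(* The exponent is shifted: bilin_pow m n is P^(n+1), the span of all products *)
(* of n.+1 elements when m is associative, since P need not have a unit.       *)
Definition bilin_pow m (n : nat) : {vspace P} :=
  iter n (fun U => bilin_span m U fullv) fullv.

Definition nilpotent_alg m : Prop := exists n, bilin_pow m n = 0%VS.

Record is_lie_bracket br : Prop := IsLieBracket {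
  lie_alternating : forall x, br x x = 0;
  lie_jacobi : forall x y z,
    br x (br y z) + br y (br z x) + br z (br x y) = 0
}.

Record is_transposed_poisson m br : Prop := IsTransposedPoisson {
  tp_mulA : associative m;
  tp_mulC : commutative m;
  tp_lie : is_lie_bracket br;
  tp_leibniz : forall x y z,
    2%:R *: m x (br y z) = br (m x y) z + br y (m x z)
}.

End BilinearProducts.

(* Main.v *)
Require Import Defs.
From HB Require Import structures.
From mathcomp Require Import all_boot all_order all_algebra.

Local Open Scope ring_scope.

Import GRing.Theory passmx.

(** Write L_x for multiplication by x and ad_x for the bracket with x. Reading
    the compatibility identity 2 x o {y, z} = {x o y, z} + {y, x o z} as an
    identity between operators applied to z, then as one applied to x, gives
      2 L_x ad_y = ad_(x o y) + ad_y L_x,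
      2 L_{y, z} = ad_y L_z - ad_z L_y.
    Taking traces, the first yields tr ad_(x o y) = tr (L_x ad_y)
    [trace_ad_mul], so tr (L_x ad_y) is symmetric in x and y because o is
    commutative; the second then yields tr L_{y, z} = 0
    [trace_lmul_bracket]. When the brackets span P, every L_x therefore has
    trace zero.

    The powers of L_x are again operators L_y since o is associative, hence all
    of them have trace zero, and in characteristic zero this makes L_x nilpotent
    [nilpotent_mx_of_traces]. Finally a finite-dimensional commutative
    associative algebra in which all the L_x are nilpotent is nilpotent: a
    Nakayama-style argument shows that a subspace I with I o P = I is zero
    [nakayama_nilpotent, bilin_span_fixed0], so the powers of P decrease
    strictly until they vanish. *)

Set Implicit Arguments.
Unset Strict Implicit.

Section MatrixTraces.

Variable F : fieldType.

(** The rank factorization A = C R satisfies R C = 1 when A is idempotent, and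
    tr (C R) = tr (R C). *)
Lemma mxtrace_idempotent n (A : 'M[F]_n) : A *m A = A -> \tr A = (\rank A)%:R.
Proof.
move=> AA; rewrite -{1}(mulmx_base A) mxtrace_mulC.
suff ->: row_base A *m col_base A = 1%:M by rewrite mxtrace1.
apply: (row_free_inj (row_base_free A)); apply: (row_full_inj (col_base_full A)).
by rewrite mul1mx mulmx_base -mulmxA mulmx_base mulmxA mulmx_base AA.
Qed.

(** If A is not nilpotent, some polynomial in A without constant term is a
    nonzero idempotent; its trace is a combination of the traces of the positive
    powers of A, but it is also its rank, which is nonzero in F. *)
Lemma nilpotent_mx_of_traces n (A : 'M[F]_n) :
  [pchar F] =i pred0 -> (forall k, \tr (A ^+ k.+1) = 0) -> exists k, A ^+ k = 0.
Proof.
move=> charF0; case: n A => [|n] A trA.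
  by exists 0; rewrite [LHS]flatmx0 [RHS]flatmx0.
have trX p : \tr (horner_mx A ('X * p)) = 0.
  rewrite -[p]coefK poly_def mulr_sumr !raddf_sum big1 // => i _ /=.
  rewrite -scalerAr -exprS linearZ /= rmorphXn /= horner_mx_X mxtraceZ trA.
  by rewrite mulr0.
have [k [q q0 chA]] := multiplicity_XsubC (char_poly A) 0.
rewrite subr0 monic_neq0 ?char_poly_monic //= in q0 chA.
(* The exponent k.+1 rather than k makes the idempotent e below a multiple of
   'X even when k = 0. *)
have /Bezout_coprimepP[[u v] /= uv1] : coprimep 'X^(k.+1) q.
  by rewrite coprimep_expl // coprimep_sym coprimepX.
have [{}u [{}v {}uv1]] : exists u v, 'X * ('X^k * u) + q * v = 1.
  have /size_poly1P[c c0 uvc] : size (u * 'X^(k.+1) + v * q) == 1%N.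
    by rewrite (eqp_size uv1) size_poly1.
  exists (c^-1 *: u), (c^-1 *: v).
  rewrite -!scalerAr -scalerDr mulrA -exprS [_ * u]mulrC [q * v]mulrC uvc.
  by rewrite -alg_polyC scalerA mulVf // scale1r.
(* Modulo the characteristic polynomial 'X^k * q, e is the idempotent that is
   0 modulo 'X^k and 1 modulo q: the projector onto the part where A is
   invertible. *)
set e := 'X * _ in uv1.
have ch0 p : horner_mx A (char_poly A * p) = 0.
  by rewrite rmorphM /= Cayley_Hamilton mul0r.
have ee : horner_mx A e *m horner_mx A e = horner_mx A e.
  rewrite -[LHS]/(horner_mx A e * horner_mx A e) -rmorphM.
  have -> : e * e = e - char_poly A * ('X * u * v).
    have -> : e * e = e * (1 - q * v) by rewrite -uv1 addrK.
    rewrite mulrBr mulr1 chA /e [q * 'X^k]mulrC -!mulrA.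
    by congr (_ - _); rewrite mulrCA !(mulrCA q) !(mulrCA u).
  by rewrite rmorphB /= ch0 subr0.
have e0 : horner_mx A e = 0.
  apply/eqP; rewrite -mxrank_eq0 -((pcharf0P F).1 charF0).
  by rewrite -mxtrace_idempotent // trX.
exists k; rewrite -[A in LHS]horner_mx_X -rmorphXn /= -['X^k]mulr1 -uv1 mulrDr.
by rewrite rmorphD rmorphM /= e0 mulr0 add0r mulrA [_ * q]mulrC -chA ch0.
Qed.

End MatrixTraces.

Section EndTrace.

Variables (F : fieldType) (P : vectType F).
Implicit Types f g : 'End(P).

Definition end_mx f : 'M[F]_(\dim {:P}) :=
  mxof (vbasis {:P}) (vbasis {:P}) f.

Definition end_trace f : F := \tr (end_mx f).

Lemma end_mx_comp f g : end_mx (f \o g)%VF = end_mx g *m end_mx f.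
Proof. exact: mxof_comp _ (vbasisP _) _ _. Qed.

Lemma end_traceD f g : end_trace (f + g) = end_trace f + end_trace g.
Proof. by rewrite /end_trace /end_mx !linearD. Qed.

Lemma end_traceZ a f : end_trace (a *: f) = a * end_trace f.
Proof. by rewrite /end_trace /end_mx !linearZ. Qed.

Lemma end_traceC f g : end_trace (f \o g)%VF = end_trace (g \o f)%VF.
Proof. by rewrite /end_trace !end_mx_comp mxtrace_mulC. Qed.

End EndTrace.

Section LeftMultiplication.

Variables (F : fieldType) (P : vectType F).
Implicit Types (m : {bilinear P -> P -> P}) (x y z : P).

Definition lmul m x : 'End(P) := linfun (m x).

Lemma lmulE m x y : lmul m x y = m x y. Proof. by rewrite lfunE. Qed.

Lemma lmulD m x y : lmul m (x + y) = lmul m x + lmul m y.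
Proof. by apply/lfunP => z; rewrite add_lfunE !lmulE linearDl. Qed.

Lemma lmulZ m a x : lmul m (a *: x) = a *: lmul m x.
Proof. by apply/lfunP => z; rewrite scale_lfunE !lmulE linearZl_LR. Qed.

(** The codomain F^o makes the trace form a linear map between vector spaces,
    so that its kernel is a subspace. *)
Definition lmul_trace m x : F^o := end_trace (lmul m x).

Fact lmul_trace_linear m : linear (lmul_trace m).
Proof.
by move=> a x y; rewrite /lmul_trace lmulD lmulZ end_traceD end_traceZ.
Qed.

HB.instance Definition _ m :=
  GRing.isLinear.Build F P F^o _ (lmul_trace m) (lmul_trace_linear m).

Section Associative.

Variable m : {bilinear P -> P -> P}.
Hypothesis mA : associative m.

(** The positive powers of L_x are themselves multiplication operators, so that
    a statement on the traces of all L_y controls the traces of all of them. *)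
Lemma end_mx_lmulX x k :
  end_mx (lmul m x) ^+ k.+1 = end_mx (lmul m (iter k (m x) x)).
Proof.
elim: k => [|k IHk]; first by rewrite expr1.
rewrite exprSr IHk /=.
have -> : lmul m (m x (iter k (m x) x)) =
    (lmul m x \o lmul m (iter k (m x) x))%VF.
  by apply/lfunP => z; rewrite comp_lfunE !lmulE mA.
by rewrite end_mx_comp.
Qed.

Lemma lmul_nilpotent x :
    [pchar F] =i pred0 -> (forall y, end_trace (lmul m y) = 0) ->
  exists k, forall u, iter k (m x) u = 0.
Proof.
move=> charF0 tr0.
have [||k Ak0] := @nilpotent_mx_of_traces F _ (end_mx (lmul m x)) => //.
  by move=> k; rewrite end_mx_lmulX; apply: tr0.
exists k => u; apply/eqP; rewrite -(rVof_eq0 (vbasisP fullv)); apply/eqP.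
rewrite -[RHS](mulmx0 _ (rVof (vbasis {:P}) u)) -Ak0.
elim: k {Ak0} => [|k IHk]; first by rewrite expr0 mulmx1.
by rewrite iterS -lmulE (rVof_app _ (vbasisP _)) IHk exprSr -mulmxA.
Qed.

Hypothesis mC : commutative m.

Lemma lmulC x y : (lmul m x \o lmul m y = lmul m y \o lmul m x)%VF.
Proof. by apply/lfunP => z; rewrite !comp_lfunE !lmulE !mA (mC x). Qed.

(** Nakayama's lemma in an algebra without unit. If I = b I + S with S stable
    under b, substituting the equality into itself gives I = b^k I + S for all
    k, hence I = S as b is nilpotent; the generators are discarded one by one. *)
Lemma nakayama_nilpotent (I : {vspace P}) (s : seq P) :
    {in s, forall b, exists k, forall u, iter k (m b) u = 0} ->
    (forall b, lmul m b @: I <= I)%VS ->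
    (I <= \sum_(b <- s) lmul m b @: I)%VS ->
  I = 0%VS.
Proof.
move=> nil_s idI; elim: s nil_s => [|b s IHs] nil_s.
  by rewrite big_nil subv0 => /eqP.
rewrite big_cons; set S := (\sum_(c <- s) _)%VS => sI.
have idS : (lmul m b @: S <= S)%VS.
  rewrite limg_sum.
  apply: (big_ind2 (fun U V => U <= V)%VS) => [|U1 V1 U2 V2|c _].
  - exact: subvv.
  - exact: addvS.
  - by rewrite -limg_comp lmulC limg_comp limgS.
have sIk k : (I <= iter k (lfun_img (lmul m b)) I + S)%VS.
  elim: k => [|k IHk]; first exact: addvSl.
  apply: subv_trans sI _; rewrite subv_add addvSr andbT.
  by apply: subv_trans (limgS _ IHk) _; rewrite limgD addvS.
apply: IHs => [c sc|]; first by apply: nil_s; rewrite inE sc orbT.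
have [k bk0] := nil_s b (mem_head b s).
suff bkI0 : (iter k (lfun_img (lmul m b)) I <= 0)%VS.
  apply: subv_trans (sIk k) _.
  by rewrite subv_add subvv andbT (subv_trans bkI0) ?sub0v.
have bkI u :
  u \in iter k (lfun_img (lmul m b)) I -> exists v, u = iter k (m b) v.
  elim: k u {bk0} => [|k IHk] u /=; first by exists u.
  by case/memv_imgP => v /IHk[w ->] ->; exists w; rewrite lmulE.
by apply/subvP => u /bkI[v ->]; rewrite bk0 mem0v.
Qed.

Hypothesis nil_m : forall x, exists k, forall u, iter k (m x) u = 0.

(** Nakayama's lemma applied to a basis of the whole algebra, all of whose
    elements are nilpotent. *)
Lemma bilin_span_fixed0 (I : {vspace P}) : bilin_span m I fullv = I -> I = 0%VS.
Proof.
move=> fixI; apply: (@nakayama_nilpotent I (vbasis {:P})) => [b _|b|] //.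
  apply/subvP => _ /memv_imgP[u Iu ->].
  by rewrite lmulE mC -fixI memv_bilin_span ?memvf.
rewrite -{1}fixI; apply/bilin_spanP => u v Iu Pv.
rewrite mC (coord_vbasis Pv) linear_sumlz; apply: memv_suml => i _.
rewrite linearZl_LR memvZ //= -lmulE.
have bi : (vbasis {:P})`_i \in val (vbasis {:P}) by rewrite mem_nth ?size_tuple.
by rewrite (big_rem _ bi) /=; apply: (subvP (addvSl _ _)); apply: memv_img.
Qed.

Lemma bilin_pow_decr n : (bilin_pow m n.+1 <= bilin_pow m n)%VS.
Proof.
elim: n => [|n IHn]; first exact: subvf.
by apply/bilin_spanP => u v /(subvP IHn) Iu Pv; apply: memv_bilin_span.
Qed.

(** The dimension of the powers drops by at least one at each step, since a
    power equal to the next one is zero. *)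
Lemma nilpotent_alg_of_elements : nilpotent_alg m.
Proof.
suff dim_pow n : (\dim (bilin_pow m n) <= \dim {:P} - n)%N.
  exists (\dim {:P}); apply/eqP.
  by rewrite -dimv_eq0 -leqn0 -(subnn (\dim {:P})) dim_pow.
elim: n => [|n IHn]; first by rewrite subn0.
have [eqI|ltI] := eqVneq (bilin_pow m n.+1) (bilin_pow m n).
  by rewrite eqI (@bilin_span_fixed0 (bilin_pow m n)) // dimv0.
have lt_dim : (\dim (bilin_pow m n.+1) < \dim (bilin_pow m n))%N.
  by rewrite ltnNge; apply: contra ltI => leI; rewrite eqEdim bilin_pow_decr.
have := leq_trans lt_dim IHn.
by rewrite subnS => lt_sub; rewrite -ltnS (ltn_predK lt_sub).
Qed.

End Associative.
End LeftMultiplication.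

Section TransposedPoisson.

Variables (F : fieldType) (P : vectType F) (mul br : {bilinear P -> P -> P}).
Hypothesis tpP : is_transposed_poisson mul br.
Hypothesis two_neq0 : 2%:R != 0 :> F.

Lemma br_antisym x y : br x y = - br y x.
Proof.
have [_ _ [alt _] _] := tpP; apply/eqP; rewrite -addr_eq0.
by rewrite -(alt (x + y)) linearDl /= !linearDr /= !alt add0r addr0.
Qed.

(** Trace of 2 L_x ad_y = ad_(x o y) + ad_y L_x, in which tr (ad_y L_x) cancels
    one copy of tr (L_x ad_y). *)
Lemma trace_ad_mul x y :
  end_trace (lmul br (mul x y)) = end_trace (lmul mul x \o lmul br y)%VF.
Proof.
apply: (addIr (end_trace (lmul mul x \o lmul br y)%VF)).
rewrite {1}end_traceC -end_traceD -[RHS]mulr2n -mulr_natl -end_traceZ.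
congr end_trace; apply/lfunP => z.
by rewrite add_lfunE scale_lfunE !comp_lfunE !lmulE (tp_leibniz tpP).
Qed.

(** Trace of 2 L_{y, z} = ad_y L_z - ad_z L_y: by the previous lemma the
    right-hand side has trace tr ad_(z o y) - tr ad_(y o z). *)
Lemma trace_lmul_bracket y z : end_trace (lmul mul (br y z)) = 0.
Proof.
apply: (mulfI two_neq0); rewrite mulr0 -end_traceZ.
have -> : 2%:R *: lmul mul (br y z) =
    (lmul br y \o lmul mul z)%VF + (-1) *: (lmul br z \o lmul mul y)%VF.
  apply/lfunP => x; rewrite add_lfunE !scale_lfunE !comp_lfunE !lmulE.
  rewrite !(tp_mulC tpP _ x) (tp_leibniz tpP) (br_antisym (mul x y)).
  by rewrite scaleN1r addrC.
rewrite end_traceD end_traceZ mulN1r 2!(end_traceC (lmul br _)) -!trace_ad_mul.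
by rewrite (tp_mulC tpP z) subrr.
Qed.

(** The kernel of the trace form is a subspace containing every bracket. *)
Lemma trace_lmul0 :
  bilin_span br fullv fullv = fullv -> forall x, end_trace (lmul mul x) = 0.
Proof.
move=> perfP x; have: x \in lker (linfun (lmul_trace mul)).
  apply: subvP (memvf x); rewrite -perfP; apply/bilin_spanP => y z _ _.
  by rewrite memv_ker lfunE /= /lmul_trace trace_lmul_bracket.
by rewrite memv_ker lfunE => /eqP.
Qed.

End TransposedPoisson.

Unset Implicit Arguments.
Set Strict Implicit.

Theorem corollary15 (F : closedFieldType) (charF0 : [pchar F] =i pred0)
    (P : vectType F) (mul br : {bilinear P -> P -> P})
    (tpP : is_transposed_poisson mul br)
    (perfP : bilin_span br fullv fullv = fullv) :
  nilpotent_alg mul.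
Proof.
have two_neq0 : 2%:R != 0 :> F by rewrite ((pcharf0P F).1 charF0).
apply: nilpotent_alg_of_elements (tp_mulA tpP) (tp_mulC tpP) _ => x.
exact: (lmul_nilpotent (tp_mulA tpP) x charF0) (trace_lmul0 tpP two_neq0 perfP).
Qed.
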